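(* Let $D=(X,\mathcal{B})$ be a $2$-$(v,k,\lambda)$ design. Then $$\gamma(D)\geq \left\lceil\frac{2v-1-\frac{k-1}{\lambda}}{k}\right\rceil.$$
   Context: Let $v,k,\lambda$ be positive integers with $v\geq k\geq 2$. A $2$-$(v,k,\lambda)$ design $D=(X,\mathcal{B})$ consists of a set $X$ of $v$ points and a family $\mathcal{B}$ of $k$-subsets of $X$ (blocks) such that every pair of distinct points is contained in exactly $\lambda$ blocks. The incidence graph $G_D$ is the bipartite graph with vertex set $X\cup\mathcal{B}$ in which a point $x$ is adjacent to a block $B$ iff $x\in B$. A dominating set of a graph is a set $S$ of vertices such that every vertex not in $S$ is adjacent to some vertex of $S$; $\gamma(D)$ denotes the minimum size of a dominating set of $G_D$. *)

(* Defs.v *)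
From mathcomp Require Import all_boot all_order all_algebra.

Set Implicit Arguments.
Unset Strict Implicit.
Unset Printing Implicit Defensive.

(* The blocks are a family indexed by the finite type B, so repeated blocks are
   allowed; a design with pairwise distinct blocks is one with injective blk. *)
Definition is_2design (X B : finType) (blk : B -> {set X})
    (v k lambda : nat) : Prop :=
  [/\ #|X| = v,
      forall b : B, #|blk b| = k
    & forall x y : X, x != y ->
        #|[set b : B | (x \in blk b) && (y \in blk b)]| = lambda].

Definition incidence_graph (X B : finType) (blk : B -> {set X}) :
    rel (X + B)%type :=
  fun u w =>
    match u, w with
    | inl x, inr b => x \in blk b
    | inr b, inl x => x \in blk b
    | _, _ => false
    end.

Definition dominating (T : finType) (e : rel T) (S : {set T}) : bool :=
  [forall u : T, (u \notin S) ==> [exists w : T, (w \in S) && e u w]].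

Lemma dominating_setT (T : finType) (e : rel T) : dominating e [set: T].
Proof. by apply/forallP=> u; rewrite in_setT. Qed.

(* The search starts from setT, which is dominating, so the arg min is attained
   at a dominating set. *)
Definition domination_number (T : finType) (e : rel T) : nat :=
  #|[arg min_(S < [set: T] | dominating e S) #|S|]|.

Lemma domination_numberP (T : finType) (e : rel T) :
  (exists2 S : {set T}, dominating e S & #|S| = domination_number e) /\
  (forall S : {set T}, dominating e S -> domination_number e <= #|S|).
Proof.
rewrite /domination_number; case: arg_minnP => [|S domS minS].
  exact: dominating_setT.
by split; [exists S | exact: minS].
Qed.

(* Main.v *)
(** Let [P] and [C] be the points and the blocks of a dominating set, [p] and
    [c] their numbers, and let [r] be the number of blocks through a point, so
    that [lambda * (v - 1) = r * (k - 1)].  At most [p * lambda] blocks through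
    a point [y] outside [P] meet [P], and all the other ones are in [C].  Hence,
    if [p * lambda + 2 <= r], every such [y] is in two blocks of [C] and
    [2 * (v - p) <= k * c].  Otherwise [y] is still in one block of [C], so that
    [v - p <= k * c], and [r <= p * lambda + 1] bounds [p] from below. *)

Require Import Defs.
From mathcomp Require Import all_boot all_order all_algebra zify lra.

Import Order.TTheory GRing.Theory Num.Theory.
Local Open Scope ring_scope.

(** Double counting of the pairs of a point [x != y] and a block through both [x] and [y]. *)
Lemma replication_eq {X B : finType} {blk : B -> {set X}} {v k lambda : nat}
    (design : is_2design blk v k lambda) (y : X) :
  (lambda * v.-1 = #|[set b | y \in blk b]| * k.-1)%N.
Proof.
case: design => vE kE lE.
transitivity (\sum_(x | x != y) \sum_(b in [set b | y \in blk b])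
                 (x \in blk b : nat))%N.
  rewrite -vE mulnC -(cardC1 y) -sum_nat_const; apply: eq_bigr => x xy.
  rewrite -(lE x y xy) -sum1_card big_mkcond [RHS]big_mkcond /=.
  by apply: eq_bigr => b _; rewrite !inE; do 2 case: (_ \in _).
rewrite exchange_big -sum_nat_const; apply: eq_bigr => b; rewrite inE => yb.
rewrite -(kE b) (cardsD1 y) yb -sum1_card big_mkcond [RHS]big_mkcond /=.
by apply: eq_bigr => x _; rewrite !inE; case: (x == y); case: (x \in blk b).
Qed.

Lemma card_sum_set {X B : finType} (S : {set X + B}) :
  #|S| = (#|[set x | inl x \in S]| + #|[set b | inr b \in S]|)%N.
Proof.
rewrite -!sum1_card big_sumType /=.
by congr (_ + _)%N; apply: eq_bigl => x; rewrite inE.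
Qed.

(** A block through [y] outside [S] is dominated by a point [x] of [S]; as [x != y], only [lambda]
    blocks arise from each such [x]. *)
Lemma replication_le_dominating {X B : finType} {blk : B -> {set X}}
    {v k lambda : nat} (design : is_2design blk v k lambda) {S : {set X + B}}
    (domS : dominating (incidence_graph blk) S) {y : X} :
  inl y \notin S ->
  (#|[set b | y \in blk b]| <=
   #|[set b | (inr b \in S) && (y \in blk b)]|
   + #|[set x | inl x \in S]| * lambda)%N.
Proof.
case: design => _ _ lE yS; set P := [set x | inl x \in S].
have /subset_leq_card : [set b | y \in blk b] \subset
    [set b | (inr b \in S) && (y \in blk b)] :|:
    \bigcup_(x in P) [set b | (x \in blk b) && (y \in blk b)].
  apply/subsetP => b; rewrite !inE => yb; rewrite yb andbT.
  have [//|bS /=] := boolP (inr b \in S).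
  have /forallP/(_ (inr b))/implyP/(_ bS)/existsP[[x|b'] /andP[xS //= xb]] := domS.
  by apply/bigcupP; exists x; rewrite inE // xb yb.
move=> /leq_trans; apply; apply: leq_trans (leq_card_setU _ _) _.
rewrite leq_add2l; rewrite -sum_nat_const.
(* Union bound over the points of [P]. *)
elim/big_ind2: _ => [|A1 m A2 n leA1 leA2|x]; first by rewrite cards0.
  exact: leq_trans (leq_card_setU _ _) (leq_add leA1 leA2).
by rewrite inE => xS; rewrite lE //; apply: contraNneq yS => <-.
Qed.

Lemma dominating_point {X B : finType} {blk : B -> {set X}} {S : {set X + B}}
    (domS : dominating (incidence_graph blk) S) {y : X} :
  inl y \notin S -> (0 < #|[set b | (inr b \in S) && (y \in blk b)]|)%N.
Proof.
move=> yS; apply/card_gt0P.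
have /forallP/(_ (inl y))/implyP/(_ yS)/existsP[[x|b] /andP[bS //= yb]] := domS.
by exists b; rewrite inE bS.
Qed.

(** Double counting of the incidences between the points outside [P] and the blocks in [C], of which
    each block carries at most [k]. *)
Lemma covering_count {X B : finType} {blk : B -> {set X}} {v k lambda m : nat}
    (design : is_2design blk v k lambda) {P : {set X}} {C : {set B}} :
  (forall y, y \notin P -> (m <= #|[set b in C | y \in blk b]|)%N) ->
  (m * v <= m * #|P| + k * #|C|)%N.
Proof.
case: design => vE kE _ mP.
rewrite -vE -(cardsC P) mulnDr leq_add2l mulnC -sum_nat_const.
apply: (@leq_trans (\sum_(y in ~: P) \sum_(b in C) (y \in blk b : nat))%N).
  apply: leq_sum => y; rewrite inE => /mP/leq_trans; apply.
  rewrite -sum1_card big_mkcond [leqRHS]big_mkcond /=.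
  by apply: leq_sum => b _; rewrite !inE; do 2 case: (_ \in _).
rewrite exchange_big mulnC -sum_nat_const; apply: leq_sum => b _.
rewrite -(kE b) -sum1_card big_mkcond [leqRHS]big_mkcond /=.
by apply: leq_sum => x _; rewrite !inE; do 2 case: (_ \in _).
Qed.

(** The final bound with both denominators cleared and the negative terms moved across, so that it
    can be proved in [nat]. *)
Lemma dominating_bound {X B : finType} {blk : B -> {set X}} {v k lambda : nat}
    (k_ge2 : (2 <= k)%N) (k_le_v : (k <= v)%N)
    (design : is_2design blk v k lambda) {S : {set X + B}} :
  dominating (incidence_graph blk) S ->
  (2 * lambda * v <= lambda * k * #|S| + lambda + k.-1)%N.
Proof.
move=> domS; rewrite card_sum_set.
set P := [set x | inl x \in S]; set C := [set b | inr b \in S].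
have CE y : [set b in C | y \in blk b] = [set b | (inr b \in S) && (y \in blk b)].
  by apply/setP => b; rewrite !inE.
have [/existsP[y /andP[yP ry]]|/existsPn noy] := boolP
    [exists y, (y \notin P) && (#|[set b | y \in blk b]| <= #|P| * lambda + 1)%N].
  have := replication_eq design y.
  have : (1 * v <= 1 * #|P| + k * #|C|)%N.
    apply: (covering_count design) => z; rewrite inE CE; exact: dominating_point.
  (* Add [lambda * (v - 1) <= (p * lambda + 1) * (k - 1)] to [lambda] times the covering
     inequality. *)
  by move: ry; nia.
have : (2 * v <= 2 * #|P| + k * #|C|)%N.
  apply: (covering_count design) => z zP.
  have := noy z; rewrite zP -ltnNge CE => rz.
  have zS : inl z \notin S by move: zP; rewrite inE.
  have := replication_le_dominating design domS zS.
  by rewrite -/P; lia.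
(* Here [2 <= k] lets points be charged at the same rate [k] as blocks. *)
have : (lambda * (2 * #|P|) <= lambda * (k * #|P|))%N by rewrite !leq_mul.
move=> leP /(leq_mul (leqnn lambda)); nia.
Qed.

Theorem theorem1p4 (X B : finType) (blk : B -> {set X}) (v k lambda : nat)
    (lambda_gt0 : (0 < lambda)%N) (k_ge2 : (2 <= k)%N) (k_le_v : (k <= v)%N)
    (design : is_2design blk v k lambda) :
  Num.ceil ((2 * v%:R - 1 - (k%:R - 1) / lambda%:R) / k%:R : rat)
    <= (domination_number (incidence_graph blk))%:Z.
Proof.
have [[S domS <-] _] := domination_numberP (incidence_graph blk).
have bound := dominating_bound k_ge2 k_le_v design domS.
have l0 : (0 : rat) < lambda%:R by rewrite ltr0n.
have k0 : (0 : rat) < k%:R by rewrite ltr0n; lia.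
rewrite ceil_le_int ler_pdivrMr // lerBlDr -lerBlDl ler_pdivlMr //.
(* Adding 1 to both sides turns [k.-1] into [k], so no truncated predecessor is cast to [rat]. *)
have : ((2 * lambda * v + 1)%N%:R : rat) <= (lambda * k * #|S| + lambda + k)%N%:R.
  rewrite ler_nat; apply: leq_trans (leq_add bound (leqnn 1)) _.
  by rewrite -addnA leq_add2l; lia.
rewrite !(natrD, natrM) -pmulrn; nra.
Qed.
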